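(* Let $C\subseteq\mathbb{R}^n$ be non-empty and compact and set $K:=C\times[0,\infty)\subseteq\mathbb{R}^{n+1}$, so that $K^\sharp=\{0\}\times[0,\infty)$. Let $s=(s_\alpha)_{\alpha\in\mathbb{N}_0^{n+1}}$ be a real sequence. Then the following are equivalent: (i) $D(s)$ is a $K$-positivity preserver; (ii) $s$ is a $K^\sharp$-moment sequence.
   Context: $D(s):=\sum_{\alpha}\frac{s_\alpha}{\alpha!}\partial^\alpha$ acting on the polynomial ring in the $n+1$ variables. A linear map $T$ is a $K$-positivity preserver if $T\,\mathrm{Pos}(K)\subseteq\mathrm{Pos}(K)$, with $\mathrm{Pos}(K)$ the polynomials non-negative on $K$. $K^\sharp:=\{x : x+K\subseteq K\}$. For closed $L$, $s$ is an $L$-moment sequence if there is a measure $\mu$ with $\mathrm{supp}\,\mu\subseteq L$ and $s_\alpha=\int x^\alpha\,\mathrm{d}\mu$ for all $\alpha$. *)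

(* Defs.v *)
From HB Require Import structures.
From mathcomp Require Import all_boot all_order all_algebra.
From mathcomp Require Import mpoly.
From mathcomp Require Import all_classical all_reals all_analysis.
Set Implicit Arguments. Unset Strict Implicit. Unset Printing Implicit Defensive.
Import Order.TTheory GRing.Theory Num.Theory.
Local Open Scope ring_scope.
Local Open Scope classical_set_scope.

Section Defs.
Variable R : realType.

Definition peval (k : nat) (p : {mpoly R[k]}) (x : 'rV[R]_k) : R := p.@[x ord0].

Definition Pos (k : nat) (K : set 'rV[R]_k) : set {mpoly R[k]} :=
  [set p | forall x, K x -> 0 <= peval p x].

Definition pos_preserver (k : nat) (K : set 'rV[R]_k)
    (T : {mpoly R[k]} -> {mpoly R[k]}) : Prop :=
  forall p, Pos K p -> Pos K (T p).

Definition Ksharp (k : nat) (K : set 'rV[R]_k) : set 'rV[R]_k :=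
  [set x | forall y, K y -> K (x + y)].

Definition mfact (k : nat) (a : 'X_{1..k}) : nat := (\prod_(i < k) (a i)`!)%N.

(* D(s) := sum_alpha s_alpha / alpha! * d^alpha.  On a polynomial p only the
   alpha with |alpha| < msize p (= total degree of p + 1) can contribute, since
   d^alpha p = 0 otherwise; so the formal infinite sum is the finite sum below. *)
Definition Dop (k : nat) (s : 'X_{1..k} -> R) (p : {mpoly R[k]}) : {mpoly R[k]} :=
  \sum_(a : 'X_{1..k < msize p})
     (s (bmnm a) / (mfact (bmnm a))%:R) *: mderivm (bmnm a) p.

Definition cylinder (n : nat) (C : set 'rV[R]_n) : set 'rV[R]_n.+1 :=
  [set x | C (\row_(i < n) x ord0 (widen_ord (leqnSn n) i)) /\ 0 <= x ord0 ord_max].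

(* measures live on (k.-tuple R) with its product (= Borel) sigma-algebra *)
Definition tuple_to_row (k : nat) (t : k.-tuple R) : 'rV[R]_k := \row_(i < k) tnth t i.

Definition msupport (k : nat) (mu : {measure set (k.-tuple R) -> \bar R})
    : set 'rV[R]_k :=
  [set x | forall e : R, 0 < e ->
     (0 < mu [set u : k.-tuple R | forall i : 'I_k, (`|tnth u i - x ord0 i| < e)%R])%E].

Definition monom_fun (k : nat) (a : 'X_{1..k}) (t : k.-tuple R) : R :=
  \prod_(i < k) tnth t i ^+ a i.

Definition moment_seq (k : nat) (L : set 'rV[R]_k) (s : 'X_{1..k} -> R) : Prop :=
  exists mu : {measure set (k.-tuple R) -> \bar R},
    msupport mu `<=` L /\
    forall a : 'X_{1..k},
      mu.-integrable setT (fun t => (monom_fun a t)%:E) /\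
      (\int[mu]_t (monom_fun a t)%:E = (s a)%:E)%E.

End Defs.

(* Main.v *)
(* Let L be the Riesz functional X^a |-> s a.  Taylor's formula gives
   (D(s) p)(x) = L (p(x + .)), so D(s) preserves positivity on K iff L is
   nonnegative on Pos(K - x) for every x in K.

   If mu represents s on K^#, then L integrates against mu, and p(x + .) is
   nonnegative on K^# for p in Pos(K) and x in K.

   Conversely, let x run over points of K whose i-th coordinate (i < n) is
   extremal on C.  At a minimum L('X_i) >= 0, at a maximum L('X_i) <= 0, and
   'X_i (d - 'X_i) >= 0 on K - x with d the width of C, so
   0 <= L('X_i^2) <= d L('X_i) = 0; by Cauchy-Schwarz L kills the ideal
   generated by 'X_i.  What remains is a Stieltjes moment problem in the last
   variable.  The functional on polynomials extends, by M. Riesz' extension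
   argument, to the indicators of the half-lines ]c, +oo[; their values H c
   form a nonincreasing function, hence define a Lebesgue-Stieltjes measure mu,
   and a layer-cake sum over the superlevel sets of t^k compares the k-th
   moment of mu with L. *)

Require Import Defs.
From HB Require Import structures.
From mathcomp Require Import all_boot all_order all_algebra.
From mathcomp Require Import mpoly.
From mathcomp Require Import all_classical all_reals all_analysis.
From mathcomp Require Import measurable_realfun ring lra.
Import Order.TTheory GRing.Theory Num.Theory.
Import numFieldNormedType.Exports.
Local Open Scope ring_scope.
Local Open Scope classical_set_scope.

(** * M. Riesz' extension theorem *)

Section RieszExtension.
Set Implicit Arguments.
Unset Strict Implicit.
Context {R : realType} {X : Type}.
Implicit Types (D : set X) (E G : set ((X -> R) * R)).

(* A partially defined linear functional on functions X -> R is encoded by its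
   graph; a linear graph that is also positive is single-valued up to D. *)
Definition linear_graph E := forall c u v, E u -> E v ->
  E ((fun x => u.1 x + c * v.1 x), u.2 + c * v.2).

Definition positive_graph D E :=
  forall u, E u -> (forall x, D x -> 0 <= u.1 x) -> 0 <= u.2.

Lemma positive_graph_le D E u v : linear_graph E -> positive_graph D E ->
  E u -> E v -> (forall x, D x -> u.1 x <= v.1 x) -> u.2 <= v.2.
Proof.
move=> lE pE Eu Ev uv; rewrite -subr_ge0.
have /pE := lE (-1) _ _ Ev Eu; rewrite /= mulN1r; apply => x Dx.
by rewrite mulN1r subr_ge0 uv.
Qed.

Lemma linear_graph_sum E (I : Type) (r : seq I) (c : I -> R) (u : I -> (X -> R) * R) v :
  linear_graph E -> E v -> (forall i, E (u i)) ->
  E ((fun x => v.1 x + \sum_(i <- r) c i * (u i).1 x),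
     v.2 + \sum_(i <- r) c i * (u i).2).
Proof.
move=> lE Ev Eu; elim: r => [|i r IH].
  rewrite big_nil addr0.
  rewrite (_ : (fun x => _) = v.1) -?surjective_pairing//.
  by apply/funext => x; rewrite /= big_nil addr0.
have := lE (c i) _ _ IH (Eu i); rewrite /= big_cons.
rewrite addrAC -addrA; congr (E (_, _)).
by apply/funext => x; rewrite /= big_cons addrAC -addrA.
Qed.

Definition graph_span G (f : X -> R) (a : R) : set ((X -> R) * R) :=
  [set w | exists u c, G u /\ w = ((fun x => u.1 x + c * f x), u.2 + c * a)].

(** The one-step extension. According to the sign of [c], dividing [0 <= u + c * f] by [c] bounds
    [f] from above or below by the element [- c^-1 * u] of [G], and the hypotheses on [a] transfer
    that bound to the values. *)
Lemma positive_graph_span D G f a : linear_graph G -> positive_graph D G ->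
  (forall u, G u -> (forall x, D x -> u.1 x <= f x) -> u.2 <= a) ->
  (forall u, G u -> (forall x, D x -> f x <= u.1 x) -> a <= u.2) ->
  (exists u, G u) ->
  linear_graph (graph_span G f a) /\ positive_graph D (graph_span G f a).
Proof.
move=> lG pG lo up [u0 Gu0]; split.
  move=> c _ _ [u [b [Gu ->]]] [v [d [Gv ->]]] /=.
  exists ((fun x => u.1 x + c * v.1 x), u.2 + c * v.2), (b + c * d).
  split; first exact: lG.
  by congr pair; [apply/funext => x /=|rewrite /=]; ring.
(* Closure is only under [u + c * v]: zero is obtained as [u0 - u0], and scalar multiples are then
   added to it. *)
have G0 : G ((fun=> 0), 0).
  have := lG (-1) _ _ Gu0 Gu0; congr (G (_, _)); last by ring.
  by apply/funext => x; ring.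
have Gscale c u : G u -> G ((fun x => c * u.1 x), c * u.2).
  move=> Gu; have := lG c _ _ G0 Gu; congr (G (_, _)); rewrite /= ?add0r//.
  by apply/funext => x; rewrite /= add0r.
move=> _ [u [c [Gu ->]]] /= h.
have [c0|c0|c0] := ltgtP c 0.
- have := up _ (Gscale (- c^-1) _ Gu) => /=.
  have c0n : 0 < - c by rewrite oppr_gt0.
  have c0' : 0 < - c^-1 by rewrite oppr_gt0 invr_lt0.
  have e : c * c^-1 = 1 by rewrite mulfV// lt_eqF.
  have hh y z : 0 <= y + c * z -> z <= - c^-1 * y.
    move=> /(mulr_ge0 (ltW c0')).
    have -> : - c^-1 * (y + c * z) = - c^-1 * y - c * c^-1 * z by ring.
    rewrite e; lra.
  have hh' y z : z <= - c^-1 * y -> 0 <= y + c * z.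
    rewrite -subr_ge0 => /(mulr_ge0 (ltW c0n)).
    have -> : - c * (- c^-1 * y - z) = c * c^-1 * y + c * z by ring.
    by rewrite e mul1r.
  by move=> H; apply/hh'/H => x Dx; apply/hh/h.
- have := lo _ (Gscale (- c^-1) _ Gu) => /=.
  have c0' : 0 < c^-1 by rewrite invr_gt0.
  have e : c * c^-1 = 1 by rewrite mulfV// gt_eqF.
  have hh y z : 0 <= y + c * z -> - c^-1 * y <= z.
    move=> /(mulr_ge0 (ltW c0')).
    have -> : c^-1 * (y + c * z) = c^-1 * y + c * c^-1 * z by ring.
    rewrite e; lra.
  have hh' y z : - c^-1 * y <= z -> 0 <= y + c * z.
    rewrite -subr_ge0 => /(mulr_ge0 (ltW c0)).
    have -> : c * (z - - c^-1 * y) = c * c^-1 * y + c * z by ring.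
    by rewrite e mul1r.
  by move=> H; apply/hh'/H => x Dx; apply/hh/h.
- rewrite c0 mul0r addr0; apply: pG => // x Dx.
  by have := h x Dx; rewrite c0 mul0r addr0.
Qed.

(** Zorn's lemma gives a maximal positive linear graph. As the constants belong to it, a function
    bounded on [D] lies between two of its elements, so a one-step extension to that function is
    possible; by maximality it is already there. *)
Lemma riesz_extension D E a1 : linear_graph E -> positive_graph D E ->
  E (cst 1, a1) ->
  exists G, [/\ E `<=` G, linear_graph G, positive_graph D G &
    forall f B, (forall x, D x -> `|f x| <= B) -> exists a, G (f, a)].
Proof.
move=> lE pE E1.
(* [Zorn_bigcup] also quantifies over the empty chain, whose union is empty. *)
pose P A := A = set0 \/ [/\ E `<=` A, linear_graph A & positive_graph D A].
have [F FP totF|A [PA maxA]] := @Zorn_bigcup _ P.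
  have [[A0 [FA0 A0n0]]|F0] := pselect (exists A, F A /\ A !=set0); last first.
    left; rewrite -subset0 => u [A FA Au]; apply: F0; exists A.
    by split => //; exists u.
  have ne A u : F A -> A u ->
      [/\ E `<=` A, linear_graph A & positive_graph D A].
    by move=> /FP[->//|].
  right; split.
  - have [u A0u] := A0n0; have [EA0 _ _] := ne _ _ FA0 A0u.
    by move=> v Ev; exists A0 => //; exact: EA0.
  - move=> c u v [A FA Au] [B FB Bv].
    have [AB|BA] := totF _ _ FA FB.
      by exists B => //; have [_ lB _] := ne _ _ FB Bv; apply: lB => //; exact: AB.
    by exists A => //; have [_ lA _] := ne _ _ FA Au; apply: lA => //; exact: BA.
  - by move=> u [A FA Au]; have [_ _] := ne _ _ FA Au; exact.
(* The maximal [A] is not empty, since [E] would be strictly larger. *)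
have [EA lA pA] : [/\ E `<=` A, linear_graph A & positive_graph D A].
  case: PA => // A0; exfalso; apply: (maxA E); last by right; split.
  by rewrite A0; split=> [x []|/(_ _ E1) []].
exists A; split=> // f B fB.
have A1 : A (cst 1, a1) by exact: EA.
have A0 : A ((fun=> 0), 0).
  have := lA (-1) _ _ A1 A1; congr (A (_, _)); rewrite /=; last by ring.
  by apply/funext => x; ring.
have Ac c : A (cst c, c * a1).
  have := lA c _ _ A0 A1; congr (A (_, _)); rewrite /= ?add0r//.
  by apply/funext => x; rewrite /= ?add0r mulr1.
(* Values at the minorants of [f]. Values at majorants bound [S] from above, so [sup S] is an
   admissible value at [f]. *)
pose S := [set a | exists u, [/\ A u, forall x, D x -> u.1 x <= f x & u.2 = a]].
have Sub v : A v -> (forall x, D x -> f x <= v.1 x) -> ubound S v.2.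
  move=> Av fv _ [u [Au uf <-]]; apply: (positive_graph_le lA pA Au Av) => x Dx.
  exact: le_trans (uf _ Dx) (fv _ Dx).
have S0 : S !=set0.
  exists (- B * a1), (cst (- B), - B * a1); split => // x Dx /=.
  by have := fB x Dx; rewrite ler_norml => /andP[].
have supS : has_sup S.
  split => //; exists (B * a1); apply: (Sub (cst B, B * a1)) => // x Dx /=.
  by have := fB x Dx; rewrite ler_norml => /andP[].
have [| | |lspan pspan] := positive_graph_span (f := f) (a := sup S) lA pA.
- by move=> u Au uf; apply: ub_le_sup; [exact: supS.2|exists u].
- by move=> u Au fu; apply: ge_sup => //; exact: Sub.
- by exists (cst 1, a1).
have sub : A `<=` graph_span A f (sup S).
  move=> u Au; exists u, 0; split => //; rewrite mul0r addr0 [LHS]surjective_pairing.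
  by congr pair; apply/funext => x; rewrite mul0r addr0.
exists (sup S).
have [//|nA] := pselect (A (f, sup S)); exfalso.
apply: (maxA (graph_span A f (sup S))).
  split => // /(_ (f, sup S)) h; apply/nA/h.
  exists ((fun=> 0), 0), 1; split => //=; rewrite mul1r add0r; congr pair.
  by apply/funext => x; rewrite /= mul1r add0r.
by right; split => //; exact: subset_trans sub.
Qed.

End RieszExtension.

(** * Measures with prescribed tails *)

Section TailMeasure.
Set Implicit Arguments.
Unset Strict Implicit.
Context {R : realType} (H : R -> R).
Hypothesis H_nincr : forall x y, x <= y -> H y <= H x.
Hypothesis H_ge0 : forall x, 0 <= H x.
Hypothesis H_vanish : forall e, 0 < e -> exists x, H x <= e.

(* The right-continuous regularization of - H. *)
Definition tail_cdf (x : R) : R := inf [set - H y | y in `]x, +oo[].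

Lemma tail_cdf_le x y : x < y -> tail_cdf x <= - H y.
Proof.
move=> xy; apply: ge_inf; last by exists y => //=; rewrite in_itv/= xy.
exists (- H x) => _ [z + <-]; rewrite /= in_itv/= andbT => xz.
by rewrite lerN2 H_nincr// ltW.
Qed.

Lemma tail_cdf_ge x m : (forall y, x < y -> m <= - H y) -> m <= tail_cdf x.
Proof.
move=> h; apply: lb_le_inf.
  by exists (- H (x + 1)), (x + 1) => //=; rewrite in_itv/= ltrDl ltr01.
by move=> _ [z + <-]; rewrite /= in_itv/= andbT => /h.
Qed.

Lemma tail_cdf_ndecr : nondecreasing tail_cdf.
Proof.
move=> x y xy; apply: tail_cdf_ge => z yz; apply: tail_cdf_le.
exact: le_lt_trans yz.
Qed.

(** A point [y > x] with [- H y] within [e] of the infimum controls [tail_cdf] on the whole of []x,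
    y[]. *)
Lemma tail_cdf_right_continuous : right_continuous tail_cdf.
Proof.
move=> x; apply/cvgrPdist_le => e e0.
have [y xy ye] : exists2 y, x < y & - H y <= tail_cdf x + e.
  apply: contrapT => h.
  have : tail_cdf x + e <= tail_cdf x.
    apply: tail_cdf_ge => z xz; rewrite leNgt; apply/negP => /ltW he.
    by apply: h; exists z.
  by rewrite gerDl leNgt e0.
near=> z.
have xz : x < z by near: z; exact: nbhs_right_gt.
have zy : z < y by near: z; exact: nbhs_right_lt.
have h1 := tail_cdf_ndecr (ltW xz); have h2 := tail_cdf_le zy.
rewrite ler_norml; apply/andP; split; lra.
Unshelve. all: by end_near. Qed.

(** The Lebesgue-Stieltjes measure of [tail_cdf] gives []c, +oo[] the right limit of [H] at [c].
    This may differ from [H c] at a jump, hence two inequalities, the second with a strict gap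
    [c < c']. *)
Lemma tail_measure T : (forall c, c < 0 -> H c = T) ->
  exists mu : {measure set (measurableTypeR R) -> \bar R},
    [/\ mu setT = T%:E,
        (forall c, (mu `]c, +oo[ <= (H c)%:E)%E) &
        (forall c c', c < c' -> ((H c')%:E <= mu `]c, +oo[)%E)].
Proof.
move=> HT.
pose f : cumulative R R := HB.pack tail_cdf
  (isCumulative.Build R _ R tail_cdf tail_cdf_ndecr tail_cdf_right_continuous).
have f_le0 x : f x <= 0.
  by apply: (le_trans (@tail_cdf_le x (x + 1) _)); rewrite ?ltrDl ?oppr_le0.
have fNy c : c < 0 -> f c = - T.
  move=> c0; apply/eqP; rewrite eq_le; apply/andP; split.
    have := @tail_cdf_le c (c / 2) _; rewrite HT; [|lra].
    by apply; lra.
  apply: tail_cdf_ge => y cy; rewrite lerN2 -(HT c) // H_nincr// ltW//.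
pose mu : {measure set (measurableTypeR R) -> \bar R} :=
    lebesgue_stieltjes_measure f.
have muoc a b : a <= b -> mu `]a, b] = (f b - f a)%:E.
  move=> ab; rewrite /mu/= /lebesgue_stieltjes_measure.
  rewrite /measure_extension measurable_mu_extE/=; last exact: is_ocitv.
  by rewrite wlength_itv_bnd.
(* Continuity from below along []c, c + n]]; [f] tends to 0 at infinity by [H_vanish]. *)
have muoy c : mu `]c, +oo[ = (- f c)%:E.
  rewrite itv_bndy_bigcup_BRight.
  have : (mu \o (fun n => `]c, c + n%:R]%classic)) n @[n --> \oo] --> (- f c)%:E.
    rewrite (_ : _ \o _ = fun n => (f (c + n%:R) - f c)%:E); last first.
      by apply/funext => n /=; rewrite muoc// lerDl.
    apply: cvg_EFin; first by near=> n.
    rewrite -[X in _ --> X]add0r; apply: cvgB; last exact: cvg_cst.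
    apply/cvgrPdist_le => e e0; have [x Hx] := H_vanish e0.
    exists (Num.trunc `|x - c|).+1 => // n /= xn.
    have xcn : x < c + n%:R.
      rewrite -ltrBlDl (le_lt_trans (ler_norm _))//.
      by rewrite (lt_le_trans (truncnS_gt _))// ler_nat.
    rewrite sub0r normrN ler0_norm ?f_le0// lerNl.
    apply: (@le_trans _ _ (- H x)); first by rewrite lerN2.
    apply: tail_cdf_ge => y /ltW ny; rewrite lerN2 H_nincr//.
    exact: le_trans (ltW xcn) ny.
  apply: cvg_unique => //; apply: nondecreasing_cvg_mu.
  - by move=> n; exact: measurable_itv.
  - by apply: bigcup_measurable => n _; exact: measurable_itv.
  - move=> m n mn; apply/subsetPset/subset_itvl; rewrite leBSide/= lerD2l ler_nat//.
exists mu; split.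
(* The endpoints start at -1, not at 0, so that [fNy] applies and every set of the sequence has mass
   [T]. *)
- have -> : [set: measurableTypeR R] = \bigcup_n `](- n.+1%:R), +oo[%classic.
    apply/seteqP; split => // x _; exists (Num.trunc `|x|) => //=.
    rewrite in_itv/= andbT ltrNl (le_lt_trans (ler_norm _))// normrN.
    exact: truncnS_gt.
  have : (mu \o (fun n => `](- n.+1%:R), +oo[%classic)) n @[n --> \oo] --> T%:E.
    rewrite (_ : _ \o _ = cst T%:E); first exact: cvg_cst.
    by apply/funext => n /=; rewrite muoy fNy ?oppr_lt0// opprK.
  apply: cvg_unique => //; apply: nondecreasing_cvg_mu.
  - by move=> n; exact: measurable_itv.
  - by apply: bigcup_measurable => n _; exact: measurable_itv.
  - move=> m n mn; apply/subsetPset/subset_itvr.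
    by rewrite leBSide/= lerN2 ler_nat ltnS.
- by move=> c; rewrite muoy lee_fin lerNl; apply: tail_cdf_ge => y cy;
    rewrite lerN2 H_nincr// ltW.
- by move=> c c' cc'; rewrite muoy lee_fin lerNr; exact: tail_cdf_le.
Unshelve. all: by end_near. Qed.

End TailMeasure.

(** * The Stieltjes moment problem *)

Section LayerSum.
Set Implicit Arguments.
Unset Strict Implicit.
Context {R : realType}.

(** For [e > 0] and [y >= 0] this is [y] rounded up to a multiple of [e] and capped at [m * e].
    Written through comparisons, it becomes a combination of indicators once [y] is a function. *)
Definition layer_sum (e : R) (m : nat) (y : R) : R :=
  \sum_(j < m) e * (e * j%:R < y)%R%:R.

Lemma layer_sum_ge (e : R) m y : 0 <= e ->
  Num.min y (m%:R * e) <= layer_sum e m y.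
Proof.
move=> e0; elim: m => [|m IH]; rewrite /layer_sum ?big_ord0 ?big_ord_recr/=.
  by rewrite mul0r ge_min lexx orbT.
have [lt|ge] := ltP (e * m%:R) y.
  rewrite ge_min; apply/orP; right; rewrite -natr1 mulrDl mul1r mulr1.
  by rewrite lerD2r (le_trans _ IH)// le_min lexx (mulrC m%:R) ltW.
rewrite mulr0 addr0 (le_trans _ IH)// le_min ge_min lexx/= ge_min.
by rewrite (mulrC m%:R) ge.
Qed.

Lemma layer_sum_le (e : R) m y : 0 <= e -> 0 <= y -> layer_sum e m y <= y + e.
Proof.
move=> e0 y0; elim: m => [|m IH]; rewrite /layer_sum ?big_ord0 ?big_ord_recr/=.
  exact: addr_ge0.
have [lt|ge] := ltP (e * m%:R) y; last by rewrite mulr0 addr0.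
rewrite mulr1 lerD2r (le_trans _ (ltW lt))//.
have -> : e * m%:R = \sum_(j < m) e by rewrite sumr_const card_ord mulr_natr.
by apply: ler_sum => i _; rewrite ler_piMr// lern1 leq_b1.
Qed.

(** The cap only matters for [y > m * e], where [y <= y ^+ 2 / (m * e)]. The loss is thus controlled
    by a higher moment. *)
Lemma layer_sum_tail (e : R) m y : 0 < e -> (0 < m)%N -> 0 <= y ->
  y <= layer_sum e m y + y ^+ 2 / (m%:R * e).
Proof.
move=> e0 m0 y0; have me0 : 0 < m%:R * e by rewrite mulr_gt0// ltr0n.
have := layer_sum_ge m y (ltW e0); case: (leP y (m%:R * e)) => h1 h2.
  by rewrite (le_trans h2)// lerDl divr_ge0 ?exprn_ge0// ltW.
rewrite (@le_trans _ _ (y ^+ 2 / (m%:R * e)))//.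
  by rewrite ler_pdivlMr// expr2 ler_pM2l ?(lt_trans me0)// ltW.
by rewrite lerDr (le_trans _ h2)// ltW.
Qed.

(** Superlevel sets of the truncated power, at levels [a >= 0], are open half-lines, where [H] and
    [mu] can be compared. *)
Lemma root_lt (k : nat) (a t : R) : 0 <= a ->
  (a < Num.max t 0 ^+ k.+1) = (a `^ (k.+1%:R^-1) < t).
Proof.
move=> a0; set c := _ `^ _; have c0 : 0 <= c by exact: powR_ge0.
have -> : a = c ^+ k.+1.
  by rewrite -powR_mulrn// -powRrM mulVf// powRr1.
rewrite ltr_pXn2r// ?nnegrE ?le_max ?lexx ?orbT// lt_max.
by rewrite [X in _ || X]ltNge c0 orbF.
Qed.

End LayerSum.

(** * Integrals of layer sums *)

Section IntegralLayer.
Set Implicit Arguments.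
Unset Strict Implicit.
Context {d : measure_display} {T : measurableType d} {R : realType}.
Variables (mu : {measure set T -> \bar R}) (g : T -> R).
Hypothesis mg : measurable_fun setT g.

Let msup (a : R) : measurable [set x | a < g x].
Proof.
rewrite [X in measurable X](_ : _ = setT `&` g @^-1` `]a, +oo[%classic).
  by apply: mg => //; exact: measurable_itv.
by apply/seteqP; split => x /=; rewrite in_itv/= andbT => // -[].
Qed.

Lemma layer_sumE (e : R) m x :
  (layer_sum e m (g x))%:E =
    (\sum_(j < m) (e * \1_[set x | (e * j%:R < g x)%R] x)%:E)%E.
Proof.
by rewrite sumEFin; congr EFin; apply: eq_bigr => j _; rewrite indicE mem_setE.
Qed.

Lemma measurable_layer_sum (e : R) m :
  measurable_fun setT (fun x => (layer_sum e m (g x))%:E).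
Proof.
under eq_fun do rewrite layer_sumE.
apply: emeasurable_sum => j; apply/measurable_EFinP.
by apply: measurable_funM => //; exact: measurable_indic.
Qed.

Lemma integral_layer_sum (e : R) m : 0 <= e ->
  (\int[mu]_x (layer_sum e m (g x))%:E =
   \sum_(j < m) e%:E * mu [set x | (e * j%:R < g x)%R])%E.
Proof.
move=> e0; under eq_integral do rewrite layer_sumE.
rewrite ge0_integral_sum//.
- apply: eq_bigr => j _; rewrite (integralZl_indic _ (fun=> [set x | e * j%:R < g x]))//.
    by rewrite integral_indic// setIT.
  by rewrite ltNge e0.
- move=> j; apply/measurable_EFinP.
  by apply: measurable_funM => //; exact: measurable_indic.
- by move=> j x _; rewrite lee_fin mulr_ge0// indicE.
Qed.

End IntegralLayer.

(** * From a positive functional on univariate polynomials to a measure *)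

Section StieltjesMoments.
Set Implicit Arguments.
Unset Strict Implicit.
Context {R : realType}.
Variable m : nat -> R.
Hypothesis m_pos : forall p : {poly R},
  (forall t, 0 <= t -> 0 <= p.[t]) -> 0 <= \sum_(i < size p) p`_i * m i.

Let Lm (p : {poly R}) := \sum_(i < size p) p`_i * m i.

Let LmE (p : {poly R}) n : (size p <= n)%N -> Lm p = \sum_(i < n) p`_i * m i.
Proof.
move=> pn; rewrite /Lm [RHS](bigID (fun i : 'I_n => (i < size p)%N))/=.
rewrite [X in _ + X]big1 ?addr0.
  by rewrite (big_ord_widen_cond _ xpredT (fun i => p`_i * m i) pn).
by move=> i; rewrite -leqNgt => ?; rewrite nth_default// mul0r.
Qed.

Let LmD c p q : Lm (p + c *: q) = Lm p + c * Lm q.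
Proof.
have sq : (size (c *: q) <= maxn (size p) (size q))%N.
  by rewrite (leq_trans (size_scale_leq _ _))// leq_maxr.
rewrite (@LmE _ (maxn (size p) (size q))); last first.
  by rewrite (leq_trans (size_polyD _ _))// geq_max leq_maxl.
rewrite (@LmE p (maxn (size p) (size q))) ?leq_maxl//.
rewrite (@LmE q (maxn (size p) (size q))) ?leq_maxr//.
rewrite mulr_sumr -big_split/=; apply: eq_bigr => i _.
by rewrite coefD coefZ mulrDl mulrA.
Qed.

Let LmX k : Lm 'X^k = m k.
Proof.
rewrite /Lm size_polyXn big_ord_recr/= big1 ?add0r.
  by rewrite coefXn eqxx mul1r.
by move=> i _; rewrite coefXn ltn_eqF ?mul0r.
Qed.

Let D : set R := [set t | 0 <= t].

Let E : set ((R -> R) * R) := [set ((fun t => p.[t]), Lm p) | p in setT].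

Let EX k : E ((fun t => t ^+ k), m k).
Proof.
exists 'X^k => //; rewrite LmX; congr pair.
by apply/funext => t; rewrite hornerXn.
Qed.

(** Indicators of half-lines are bounded by 1, so the Riesz extension of the polynomial functional
    reaches them; [H] collects their values by choice. *)
Lemma moment_tail_extension : exists G (H : R -> R),
  [/\ linear_graph G, positive_graph D G,
      forall k, G ((fun t => t ^+ k), m k) &
      forall c, G ((fun t => (c < t)%R%:R), H c)].
Proof.
have lE : linear_graph E.
  move=> c _ _ [p _ <-] [q _ <-]; exists (p + c *: q) => //=; rewrite LmD.
  by congr pair; apply/funext => t; rewrite hornerD hornerZ.
have pE : positive_graph D E by move=> _ [p _ <-] /= h; exact: m_pos.
have [|G [EG lG pG bG]] := riesz_extension (a1 := m 0%N) lE pE.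
  by have := EX 0; congr (E (_, _)); apply/funext => t; rewrite expr0.
have hH c : exists a, G ((fun t => (c < t)%R%:R), a).
  by apply: (bG _ 1) => t _; rewrite ger0_norm// lern1 leq_b1.
exists G, (fun c => projT1 (cid (hH c))); split => // [k|c]; first exact/EG/EX.
by case: cid.
Qed.

(** * Tails of the extended functional and moments of the measure *)

Section Extension.
Variables (G : set ((R -> R) * R)) (H : R -> R).
Hypothesis lG : linear_graph G.
Hypothesis pG : positive_graph D G.
Hypothesis GX : forall k, G ((fun t => t ^+ k), m k).
Hypothesis GH : forall c, G ((fun t => (c < t)%R%:R), H c).

Let G_le u v : G u -> G v -> (forall x, D x -> u.1 x <= v.1 x) -> u.2 <= v.2.
Proof. exact: positive_graph_le. Qed.

Lemma tail_nonincreasing x y : x <= y -> H y <= H x.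
Proof.
move=> xy; apply: (G_le (GH y) (GH x)) => t _ /=; rewrite ler_nat.
by case: ltP => // yt; rewrite (le_lt_trans xy yt).
Qed.

Lemma tail_ge0 x : 0 <= H x.
Proof. exact: (pG (GH x)). Qed.

Lemma tail_mass c : c < 0 -> H c = m 0%N.
Proof.
move=> c0; apply/eqP; rewrite eq_le; apply/andP; split.
  by apply: (G_le (GH c) (GX 0)) => t _ /=; rewrite expr0 lern1 leq_b1.
by apply: (G_le (GX 0) (GH c)) => t Dt /=; rewrite expr0 (lt_le_trans c0 Dt).
Qed.

Let m_ge0 k : 0 <= m k.
Proof. by apply: (pG (GX k)) => t Dt; exact: exprn_ge0. Qed.

Let tail_le_mass c : H c <= m 0%N.
Proof.
by apply: (G_le (GH c) (GX 0)) => t _ /=; rewrite expr0 lern1 leq_b1.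
Qed.

Let G0 : G ((fun=> 0), 0).
Proof.
have := lG (-1) (GX 0) (GX 0); congr (G (_, _)); rewrite /=; last by ring.
by apply/funext => x; ring.
Qed.

Let Gscale c k : G ((fun x => c * x ^+ k), c * m k).
Proof.
have := lG c G0 (GX k); congr (G (_, _)); rewrite /= ?add0r//.
by apply/funext => x; rewrite add0r.
Qed.

(** Markov's inequality with the first moment: on [D] the indicator of []c, +oo[] is at most
    [t / c]. *)
Lemma tail_vanishes e : 0 < e -> exists x, H x <= e.
Proof.
(* Adding 1 keeps the threshold positive even if [m 1] is zero. *)
move=> e0; exists ((m 1%N + 1) / e).
have m1 : 0 < m 1%N + 1 by rewrite ltr_wpDl.
have c0 : 0 < (m 1%N + 1) / e by rewrite divr_gt0.
apply: (@le_trans _ _ (e / (m 1%N + 1) * m 1%N)).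
  apply: (G_le (GH _) (Gscale _ _)) => t Dt /=; rewrite expr1.
  have [ct|_] := ltP _ t; last by rewrite mulr_ge0// divr_ge0// ltW.
  by rewrite mulrC -ler_pdivrMr ?divr_gt0// mul1r invf_div ltW.
by rewrite -mulrA ler_piMr ?ltW// mulrC ltr_pdivrMr// mul1r ltrDl.
Qed.

Let rt k (a : R) := a `^ (k.+1%:R^-1).

Let G_layer (k : nat) e n v : G v ->
  G ((fun t => v.1 t + \sum_(j < n) e * (rt k (e * j%:R) < t)%R%:R),
     v.2 + \sum_(j < n) e * H (rt k (e * j%:R))).
Proof.
by move=> Gv; apply: (linear_graph_sum _ (fun=> e)
  (u := fun j : 'I_n => ((fun t => (rt k (e * j%:R) < t)%R%:R),
    H (rt k (e * j%:R)))) lG Gv).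
Qed.

Let layer_rt k e n t : 0 <= e -> 0 <= t ->
  \sum_(j < n) e * (rt k (e * j%:R) < t)%R%:R = layer_sum e n (t ^+ k.+1).
Proof.
move=> e0 t0; apply: eq_bigr => j _; rewrite -root_lt ?mulr_ge0//.
by rewrite max_l.
Qed.

(** The pointwise bound [layer_sum_le] at [t ^+ k.+1], carried to the values by positivity. *)
Let layer_H_le k e n : 0 < e ->
  \sum_(j < n) e * H (rt k (e * j%:R)) <= m k.+1 + e * m 0%N.
Proof.
move=> e0; rewrite -[leLHS]add0r.
apply: (G_le (G_layer k e n G0) (lG e (GX k.+1) (GX 0))) => t Dt /=.
rewrite add0r expr0 mulr1 layer_rt ?(ltW e0)//.
by apply: layer_sum_le; [exact: ltW|exact: exprn_ge0].
Qed.

(** Here [layer_sum_tail] is used at [t ^+ k.+1]; its quadratic error term becomes the moment of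
    order [k.+1 * 2]. *)
Let le_layer_H k e n : 0 < e -> (0 < n)%N ->
  m k.+1 <= (n%:R * e)^-1 * m (k.+1 * 2)%N + \sum_(j < n) e * H (rt k (e * j%:R)).
Proof.
move=> e0 n0; apply: (G_le (GX _) (G_layer k e n (Gscale _ _))) => t Dt /=.
rewrite layer_rt ?(ltW e0)// addrC mulrC exprM.
by apply: layer_sum_tail => //; exact: exprn_ge0.
Qed.

Variable mu : {measure set (measurableTypeR R) -> \bar R}.
Hypothesis muT : mu setT = (m 0%N)%:E.
Hypothesis mu_le : forall c, (mu `]c, +oo[ <= (H c)%:E)%E.
Hypothesis mu_ge : forall c c', c < c' -> ((H c')%:E <= mu `]c, +oo[)%E.

(* Truncating at 0 avoids having to know that mu charges only `[0, +oo[. *)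
Let g k (t : measurableTypeR R) : R := Num.max t 0 ^+ k.

Let g_ge0 k t : 0 <= g k t.
Proof. by rewrite /g exprn_ge0// le_max lexx orbT. Qed.

Let mg k : measurable_fun setT (g k).
Proof.
by apply: measurable_funX; apply: measurable_maxr.
Qed.

Let int_layer k e n : 0 < e ->
  (\int[mu]_x (layer_sum e n (g k.+1 x))%:E =
   \sum_(j < n) e%:E * mu `]rt k (e * j%:R), +oo[)%E.
Proof.
move=> e0; rewrite integral_layer_sum ?ltW//; apply: eq_bigr => j _.
congr (_ * mu _)%E; apply/seteqP.
by split => t /=; rewrite in_itv/= andbT root_lt// mulr_ge0// ltW.
Qed.

(** Below the cap [M] finitely many layers suffice: their sum dominates the integrand, [mu_le]
    replaces [mu] by [H], and [layer_H_le] returns to the moment. *)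
Let int_min_le k M : 0 <= M ->
  (\int[mu]_x (Num.min (g k.+1 x) M)%:E <= (m k.+1)%:E)%E.
Proof.
move=> M0; apply/lee_addgt0Pr => d d0.
(* Makes the rounding error [e * m 0] at most [d]; the added 1 avoids a zero denominator. *)
pose e := d / (m 0%N + 1).
have m01 : 0 < m 0%N + 1 by rewrite ltr_wpDl.
have e0 : 0 < e by rewrite divr_gt0.
pose n := (Num.trunc (M / e)).+1.
have Mn : M <= n%:R * e by rewrite -ler_pdivrMr// ltW// truncnS_gt.
apply: (@le_trans _ _ (\int[mu]_x (layer_sum e n (g k.+1 x))%:E)%E).
  apply: ge0_le_integral => //.
  - by move=> x _; rewrite lee_fin le_min g_ge0.
  - by apply/measurable_EFinP; apply: measurable_minr.
  - exact: measurable_layer_sum.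
  - move=> x _; rewrite lee_fin; apply: le_trans (layer_sum_ge _ _ (ltW e0)).
    by rewrite le_min !ge_min lexx Mn orbT.
rewrite int_layer//.
apply: (@le_trans _ _ (\sum_(j < n) (e * H (rt k (e * j%:R)))%:E)%E).
  apply: lee_sum => j _; rewrite (EFinM e); apply: lee_wpmul2l => //.
  by rewrite lee_fin ltW.
rewrite sumEFin -EFinD lee_fin; apply: (le_trans (layer_H_le _ _ e0)).
rewrite lerD2l /e -mulrA ler_piMr ?ltW// mulrC ltr_pdivrMr// mul1r ltrDl//.
Qed.

(** Monotone convergence along the caps [n] removes the truncation. *)
Let int_le k : (\int[mu]_x (g k.+1 x)%:E <= (m k.+1)%:E)%E.
Proof.
have -> : (\int[mu]_x (g k.+1 x)%:E =
    \int[mu]_x (limn (fun n => (Num.min (g k.+1 x) n%:R)%:E)))%E.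
  apply: eq_integral => x _; apply/esym/cvg_lim => //.
  apply: cvg_near_cst; exists (Num.trunc (g k.+1 x)).+1 => // n /= xn.
  congr EFin; apply: min_l; rewrite ltW// (lt_le_trans (truncnS_gt _))//.
  by rewrite ler_nat.
rewrite monotone_convergence//.
- apply: lime_le; last by apply: nearW => n; exact: int_min_le.
  apply: ereal_nondecreasing_is_cvgn => p q pq; apply: ge0_le_integral => //.
  + by move=> x _; rewrite lee_fin le_min g_ge0/=.
  + by apply/measurable_EFinP; apply: measurable_minr.
  + by apply/measurable_EFinP; apply: measurable_minr.
  + move=> x _; rewrite lee_fin le_min !ge_min lexx/=.
    by rewrite [X in _ || X](_ : _ = true) ?orbT// ler_nat.
- by move=> n; apply/measurable_EFinP; apply: measurable_minr.
- by move=> n x _; rewrite lee_fin le_min g_ge0/=.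
- move=> x _ p q pq; rewrite lee_fin le_min !ge_min lexx/=.
  by rewrite [X in _ || X](_ : _ = true) ?orbT// ler_nat.
Qed.

Let int_ge k : ((m k.+1)%:E <= \int[mu]_x (g k.+1 x)%:E)%E.
Proof.
apply/lee_addgt0Pr => d d0.
(* The error [e * m 0] occurs twice, for the lowest layer and for rounding up; together these cost
   at most [d / 2]. The other half is for the cap, through the choice of [n]. *)
pose e := d / (4 * (m 0%N + 1)).
have m01 : 0 < m 0%N + 1 by rewrite ltr_wpDl.
have e0 : 0 < e by apply: divr_gt0 => //; exact: mulr_gt0.
have em : e * (m 0%N + 1) = d / 4.
  by rewrite /e; field; rewrite gt_eqF.
pose q := m (k.+1 * 2)%N.
pose n := Num.trunc (2 * q / (d * e)).
have hn : (n.+1%:R * e)^-1 * q <= d / 2.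
  have := truncnS_gt (2 * q / (d * e)); rewrite -/n.
  rewrite ltr_pdivrMr ?(mulr_gt0 d0 e0)// => h.
  have ne0 : 0 < n.+1%:R * e by rewrite mulr_gt0// ltr0n.
  rewrite mulrC ler_pdivrMr//; nra.
have hsum : ((\sum_(j < n.+1) e * H (rt k (e * j%:R)))%:E <=
    (\int[mu]_x (g k.+1 x)%:E + (2 * e * m 0%N)%:E)%E)%E.
  (* [mu_ge] needs a strictly smaller threshold, so [H] at level [j + 1] is compared with [mu] at
     level [j]. Level 0 is left over and is bounded by [e * m 0]. *)
  rewrite big_ord_recl EFinD addeC.
  apply: (@le_trans _ _ (\int[mu]_x (layer_sum e n (g k.+1 x))%:E +
      (e * m 0%N)%:E)%E).
    apply: leeD; last by rewrite lee_fin ler_wpM2l// ltW.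
    rewrite int_layer// -sumEFin; apply: lee_sum => j _.
    rewrite (EFinM e); apply: lee_wpmul2l; first by rewrite lee_fin ltW.
    apply: mu_ge; apply: gt0_ltr_powR.
    - by rewrite invr_gt0 ltr0n.
    - by rewrite nnegrE mulr_ge0// ltW.
    - by rewrite nnegrE mulr_ge0// ltW.
    - by rewrite ltr_pM2l// ltr_nat.
  rewrite -mulrA mulr_natl mulr2n EFinD addeA; apply: leeD => //.
  have -> : (e * m 0%N)%:E = (\int[mu]_x (cst e%:E) x)%E.
    by rewrite integral_cst// (EFinM e) muT.
  rewrite -ge0_integralD//.
  - apply: ge0_le_integral => //.
    + by move=> x _; rewrite lee_fin sumr_ge0// => j _; rewrite mulr_ge0// ltW.
    + exact: measurable_layer_sum.
    + by apply: emeasurable_funD => //; apply/measurable_EFinP.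
    + by move=> x _; rewrite lee_fin layer_sum_le// ltW.
  - by move=> x _; rewrite lee_fin.
  - by apply/measurable_EFinP.
  - by move=> x _; rewrite lee_fin ltW.
apply: (@le_trans _ _ ((d / 2)%:E +
    (\int[mu]_x (g k.+1 x)%:E + (2 * e * m 0%N)%:E))%E).
  apply: (le_trans _ (leeD2l _ hsum)).
  rewrite -EFinD lee_fin; apply: (le_trans (@le_layer_H k e n.+1 e0 _)) => //.
  by rewrite lerD2r.
rewrite addeCA; apply: leeD => //; rewrite -EFinD lee_fin; nra.
Qed.

Lemma moments_of_tail_bounds k :
  mu.-integrable setT (fun t => (Num.max t 0 ^+ k)%:E) /\
  (\int[mu]_t (Num.max t 0 ^+ k)%:E = (m k)%:E)%E.
Proof.
have int_g : (\int[mu]_t (g k t)%:E = (m k)%:E)%E.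
  case: k => [|k]; last by apply/eqP; rewrite eq_le int_le int_ge.
  under eq_integral do rewrite /g expr0.
  by rewrite integral_cst// mul1e.
split=> //; apply/integrableP; split; first by apply/measurable_EFinP; exact: mg.
rewrite (eq_integral (fun t => (g k t)%:E)); first by rewrite int_g ltry.
by move=> t _; rewrite gee0_abs// lee_fin; exact: g_ge0.
Qed.

End Extension.
(** The image of [mu] under [t |-> max t 0] is the Stieltjes measure; that map is composed later
    with the embedding of the axis. *)
Lemma stieltjes_moments : exists mu : {measure set (measurableTypeR R) -> \bar R},
  forall k, mu.-integrable setT (fun t => (Num.max t 0 ^+ k)%:E) /\
    (\int[mu]_t (Num.max t 0 ^+ k)%:E = (m k)%:E)%E.
Proof.
have [G [H [lG pG GX GH]]] := moment_tail_extension.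
have [mu [muT mu_le mu_ge]] := tail_measure (tail_nonincreasing lG pG GH) (tail_ge0 pG GH)
  (tail_vanishes lG pG GX GH) (tail_mass lG pG GX GH).
by exists mu => k; apply: (moments_of_tail_bounds lG pG GX GH muT mu_le mu_ge).
Qed.

End StieltjesMoments.

(** * Taylor's formula *)

Section Taylor.
Set Implicit Arguments.
Unset Strict Implicit.
Context {R : realType} {k : nat}.
Implicit Types (p q : {mpoly R[k]}) (s : 'X_{1..k} -> R) (x : 'I_k -> R).

Definition riesz_functional s q : R := \sum_(a <- msupp q) q@_a * s a.

Lemma riesz_functionalwE s q d : (msize q <= d)%N ->
  riesz_functional s q = \sum_(a : 'X_{1..k < d}) q@_a * s a.
Proof.
move=> qd; pose P (a : 'X_{1..k < d}) := val a \in msupp q.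
rewrite [RHS](bigID P) {}/P /= addrC big1 ?add0r; last first.
  by move=> a /memN_msupp_eq0 ->; rewrite mul0r.
rewrite /riesz_functional (ssrcomplements.big_mksub 'X_{1..k < d}) //=; first exact/msupp_uniq.
by move=> a /msize_mdeg_lt /leq_trans; apply.
Qed.

Lemma riesz_functionalD s c p q :
  riesz_functional s (p + c *: q) = riesz_functional s p + c * riesz_functional s q.
Proof.
have [d [pd qd pqd]] : exists d,
    [/\ msize p <= d, msize q <= d & msize (p + c *: q) <= d]%N.
  exists (maxn (msize p) (maxn (msize q) (msize (p + c *: q)))).
  by rewrite !leq_max !leqnn !orbT.
rewrite (riesz_functionalwE _ pd) (riesz_functionalwE _ qd) (riesz_functionalwE _ pqd).
rewrite mulr_sumr -big_split/=; apply: eq_bigr => a _.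
by rewrite mcoeffD mcoeffZ mulrDl mulrA.
Qed.

Lemma riesz_functionalX s a : riesz_functional s 'X_[a] = s a.
Proof. by rewrite /riesz_functional msuppX big_seq1 mcoeffX eqxx mul1r. Qed.

Definition mshift x p := p \mPo [tuple 'X_i + (x i)%:MP | i < k].

Lemma meval_mshift x p y : (mshift x p).@[y] = p.@[fun i => y i + x i].
Proof.
rewrite comp_mpoly_meval; apply: meval_eq => i.
by rewrite tnth_mktuple mevalD mevalXU mevalC.
Qed.

Lemma mshiftM x : {morph mshift x : p q / p * q}.
Proof. by move=> p q; rewrite /mshift rmorphM. Qed.

Lemma mshiftD x : {morph mshift x : p q / p + q}.
Proof. by move=> p q; rewrite /mshift comp_mpolyD. Qed.

Lemma mshiftZ x c : {morph mshift x : p / c *: p}.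
Proof. by move=> p; rewrite /mshift comp_mpolyZ. Qed.

Lemma mshiftK x p : mshift x (mshift (fun i => - x i) p) = p.
Proof.
elim/mpolyind: p => [|c a p _ _ IH]; first by rewrite /mshift !comp_mpoly0.
rewrite !(mshiftD, mshiftZ) IH; congr (_ *: _ + _).
rewrite {2}/mshift comp_mpolyX /mshift rmorph_prod/= mpolyXE_id.
apply: eq_bigr => i _; rewrite rmorphXn/= tnth_mktuple comp_mpolyD comp_mpolyC.
by rewrite comp_mpolyXU -tnth_nth tnth_mktuple mpolyCN addrK.
Qed.

(** Checked on the variables, the identity passes to monomials by the Leibniz rule and to all
    polynomials by linearity. *)
Lemma mderiv_mshift x i p : (mshift x p)^`M(i) = mshift x p^`M(i).
Proof.
pose P q := (mshift x q)^`M(i) = mshift x q^`M(i).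
have PX (j : 'I_k) : P 'X_j.
  rewrite /P /mshift comp_mpolyXU -tnth_nth tnth_mktuple mderivD mderivC addr0.
  rewrite mderivX mnm1E; case: eqP => [->|_].
    rewrite scale1r (_ : U_(i) - U_(i) = 0)%MM ?mpolyX0 ?comp_mpoly1//.
    by apply/mnmP => l; rewrite mnmBE mnm0E subnn.
  by rewrite !scale0r comp_mpoly0.
have PM p1 p2 : P p1 -> P p2 -> P (p1 * p2).
  by rewrite /P => h1 h2; rewrite mshiftM !mderivM h1 h2 mshiftD !mshiftM.
have P1 : P 1 by rewrite /P /mshift comp_mpoly1 -mpolyC1 mderivC comp_mpoly0.
have PXm a : P 'X_[a].
  rewrite mpolyXE_id; apply: big_ind => // j _.
  by elim: (a j) => [|n IH]; rewrite ?expr0// exprS; exact: PM.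
elim/mpolyind: p => [|c a p _ _ IH].
  by rewrite /mshift comp_mpoly0 !mderiv0 comp_mpoly0.
by rewrite !(mshiftD, mshiftZ, mderivD, mderivZ) IH PXm.
Qed.

Lemma mderivm_mshift x a p : (mshift x p)^`M[a] = mshift x p^`M[a].
Proof.
by rewrite !mderivm_foldr; elim: (flatten _) => //= i r ->; exact: mderiv_mshift.
Qed.

Lemma meval_fun0 q : q.@[fun=> 0] = q@_0.
Proof.
elim/mpolyind: q => [|c a q _ _ IH]; first by rewrite meval0 mcoeff0.
rewrite mevalD mevalZ mevalX mcoeffD mcoeffZ mcoeffX IH; congr (_ * _ + _).
case: eqP => [->|/eqP a0]; first by rewrite big1// => i _; rewrite mnm0E.
have [i ai] : exists i, a i != 0%N.
  by apply/existsP; rewrite -negb_forall; apply: contraNN a0 => /forallP h;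
    apply/eqP/mnmP => i; rewrite mnm0E; exact/eqP/h.
by rewrite (bigD1 i)//= expr0n (negbTE ai) mul0r.
Qed.

(** Taylor coefficients, read off by differentiating the translate and evaluating it at the
    origin. *)
Lemma mcoeff_mshift x a p : (mfact a)%:R * (mshift x p)@_a = (p^`M[a]).@[x].
Proof.
have -> : (p^`M[a]).@[x] = ((mshift x p)^`M[a])@_0.
  rewrite mderivm_mshift; transitivity ((mshift x p^`M[a]).@[fun=> 0]).
    by rewrite meval_mshift; apply: meval_eq => i; rewrite add0r.
  exact: meval_fun0.
rewrite mcoeff_mderivm addm0 mulr_natl; congr (_ *+ _).
by apply: eq_bigr => i _; rewrite ffactnn.
Qed.

(** Ensures that the index set of [Dop], cut at [msize p], covers the support of the translate.
    Coefficients beyond it are multiples of derivatives of [p] that vanish. *)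
Lemma msize_mshift x p : (msize (mshift x p) <= msize p)%N.
Proof.
rewrite msizeE; apply/bigmax_leqP_seq => a; rewrite mcoeff_msupp => a0 _.
rewrite ltnNge; apply: contraNN a0 => pa; apply/eqP.
have mf0 : (mfact a)%:R != 0 :> R.
  by rewrite pnatr_eq0 -lt0n; apply: prodn_gt0 => i; exact: fact_gt0.
apply: (mulfI mf0); rewrite mcoeff_mshift mulr0.
rewrite (_ : p^`M[a] = 0) ?meval0//; apply/mpolyP => b.
rewrite mcoeff_mderivm mcoeff0 memN_msupp_eq0 ?mul0rn//.
apply/negP => /msize_mdeg_lt; rewrite mdegD ltnNge => /negP; apply.
by rewrite (leq_trans pa)// leq_addr.
Qed.

Lemma peval_Dop s p (v : 'rV[R]_k) :
  peval (Dop s p) v = riesz_functional s (mshift (v ord0) p).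
Proof.
rewrite (riesz_functionalwE _ (msize_mshift (v ord0) p)).
rewrite /peval /Dop raddf_sum/=; apply: eq_bigr => a _.
rewrite mevalZ -mcoeff_mshift mulrA divfK 1?mulrC//.
by rewrite pnatr_eq0 -lt0n; apply: prodn_gt0 => i; exact: fact_gt0.
Qed.

End Taylor.

(** * Integration of polynomials against a representing measure *)

Section MomentFunctional.
Set Implicit Arguments.
Unset Strict Implicit.
Context {R : realType} {k : nat} (mu : {measure set (k.-tuple R) -> \bar R}).

Let box (c : 'I_k -> R) (r : R) : set (k.-tuple R) :=
  [set u | forall i, `|tnth u i - c i| < r].

Let measurable_box c r : measurable (box c r).
Proof.
have -> : box c r = \bigcap_(i in [set: 'I_k])
    (setT `&` (fun u : k.-tuple R => tnth u i) @^-1` `]c i - r, c i + r[%classic).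
  apply/seteqP; split => u /=.
    by move=> h i _; split => //=; rewrite in_itv/= -ltr_distl.
  by move=> h i; have [_] := h i I; rewrite /= in_itv/= -ltr_distl.
apply: fin_bigcap_measurable => // i _.
by apply: measurable_tnth => //; exact: measurable_itv.
Qed.

(** Every point outside the support lies in a null box from a countable family. *)
Lemma negligible_msupportC : mu.-negligible [set u | ~ msupport mu (tuple_to_row u)].
Proof.
(* Boxes with rational centre and radius 1 / (N + 1). *)
pose I := ({ffun 'I_k -> rat} * nat)%type.
pose B (i : I) := box (fun j => ratr (i.1 j)) (i.2.+1%:R^-1).
(* Boxes of non-zero mass and codes of no box become [set0], so each [F n] is null. *)
pose F n := if unpickle n is Some i then
  (if mu (B i) == 0%E then B i else set0) else set0.
apply: (@negligibleS _ _ _ mu (\bigcup_n F n)); last first.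
  apply: negligible_bigcup => n; rewrite /F.
  case: unpickle => [i|]; last exact: negligible_set0.
  case: eqP => [mu0|_]; last exact: negligible_set0.
  by exists (B i); split => //; exact: measurable_box.
move=> u /= /existsNP[e /not_implyP[e0 /negP]].
rewrite -leNgt => mule.
(* With radius below [e / 2], a rational box containing [u] stays inside the null box of radius [e]
   around [u]. *)
pose N := Num.trunc (2 / e).
have Ne : N.+1%:R^-1 < e / 2.
  by rewrite -[e / 2]invf_div ltf_pV2 ?posrE ?divr_gt0 ?ltr0n// truncnS_gt.
have N0 : 0 < N.+1%:R^-1 :> R by rewrite invr_gt0 ltr0n.
have hc i : exists q : rat, `|tnth u i - ratr q| < N.+1%:R^-1.
  have [|q] := @rat_in_itvoo R (tnth u i - N.+1%:R^-1) (tnth u i + N.+1%:R^-1).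
    by rewrite ltrBlDr -addrA ltrDl addr_gt0.
  by rewrite in_itv/= -ltr_distl distrC; exists q.
pose c := [ffun i => projT1 (cid (hc i))].
have Bu : B (c, N) u.
  by move=> i /=; rewrite ffunE; case: cid.
exists (pickle ((c, N) : I)) => //; rewrite /F pickleK.
case: eqP => // mB; exfalso; apply: mB; apply/eqP; rewrite eq_le measure_ge0 andbT.
apply: le_trans mule; apply: le_measure; rewrite ?inE.
- exact: measurable_box.
- rewrite [X in measurable X](_ : _ = box (fun i => tnth u i) e).
    exact: measurable_box.
  by apply/seteqP; split => v /= h i; have := h i; rewrite mxE.
- move=> v /= Bv i; rewrite mxE.
  have := Bv i; have := Bu i; rewrite /= => h1 h2.
  rewrite -(subrKA (ratr (c i))) (le_lt_trans (ler_normD _ _))//.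
  rewrite (splitr e) ltrD//; first exact: lt_trans h2 Ne.
  by rewrite distrC; exact: lt_trans h1 Ne.
Qed.

Variable s : 'X_{1..k} -> R.
Hypothesis mus : forall a, mu.-integrable setT (fun t => (monom_fun a t)%:E) /\
  (\int[mu]_t (monom_fun a t)%:E = (s a)%:E)%E.

Lemma integral_mpoly (q : {mpoly R[k]}) :
  mu.-integrable setT (fun t => (q.@[tnth t])%:E) /\
  (\int[mu]_t (q.@[tnth t])%:E = (riesz_functional s q)%:E)%E.
Proof.
have e t : (q.@[tnth t])%:E = (\sum_(a <- msupp q) (q@_a)%:E * (monom_fun a t)%:E)%E.
  by rewrite mevalE -sumEFin; apply: eq_bigr => a _; rewrite EFinM.
split.
  under eq_fun do rewrite e.
  by apply: integrable_sum => // a _; apply: integrableZl => //; exact: (mus a).1.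
under eq_integral do rewrite e.
rewrite integral_sum//; last first.
  by move=> a; apply: integrableZl => //; exact: (mus a).1.
rewrite -sumEFin; apply: eq_bigr => a _.
by rewrite integralZl//; [rewrite (mus a).2 EFinM|exact: (mus a).1].
Qed.

Lemma riesz_functional_ge0 (L : set 'rV[R]_k) (q : {mpoly R[k]}) :
  msupport mu `<=` L -> (forall y, L y -> 0 <= peval q y) ->
  0 <= riesz_functional s q.
Proof.
move=> muL Lq; have [iq int_q] := integral_mpoly q.
have [N [mN muN0 subN]] := negligible_msupportC.
rewrite -lee_fin -int_q (negligible_integral mN)//.
apply: integral_ge0 => u [_ Nu]; rewrite lee_fin.
have /contrapT/muL/Lq := contra_not (subN u) Nu; rewrite /peval.
by congr (0 <= _); apply: meval_eq => i; rewrite mxE.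
Qed.

End MomentFunctional.

(** * Positivity preservers on a cylinder *)

Section Cylinder.
Set Implicit Arguments.
Unset Strict Implicit.
Context {R : realType} {n : nat}.
Variables (C : set 'rV[R^o]_n) (s : 'X_{1..n.+1} -> R).
Hypothesis C_neq0 : C !=set0.
Hypothesis C_compact : compact C.
Hypothesis s_pos : pos_preserver (cylinder C) (Dop s).

Let base (i : 'I_n) : 'I_n.+1 := widen_ord (leqnSn n) i.

Let Ls := riesz_functional s.

Let lift_row (c : 'rV[R^o]_n) (h : R) : 'rV[R]_n.+1 :=
  \row_j oapp (fun i => c ord0 i) h (unlift ord_max j).

Let base_lift i : base i = lift ord_max i.
Proof. by apply/val_inj; rewrite /= /bump leqNgt ltn_ord. Qed.

Let base_max i : (base i == ord_max) = false.
Proof. by rewrite base_lift eq_sym; exact/negbTE/neq_lift. Qed.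

Let lift_row_base c h i : lift_row c h ord0 (base i) = c ord0 i.
Proof. by rewrite mxE base_lift liftK. Qed.

Let lift_row_max c h : lift_row c h ord0 ord_max = h.
Proof. by rewrite mxE unlift_none. Qed.

Let cylinder_lift c h : C c -> 0 <= h -> cylinder C (lift_row c h).
Proof.
move=> Cc h0; split; last by rewrite lift_row_max.
rewrite (_ : \row_i _ = c)//; apply/rowP => i.
by rewrite mxE -/(base i) lift_row_base.
Qed.

(** The working form of [s_pos]: it is applied to [q] translated by [- x] and evaluated at [x],
    where the two translations cancel. *)
Lemma riesz_functional_ge0_shift (x : 'rV[R]_n.+1) (q : {mpoly R[n.+1]}) :
  cylinder C x ->
  (forall y, cylinder C y -> 0 <= q.@[fun i => y ord0 i - x ord0 i]) ->
  0 <= Ls q.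
Proof.
move=> Kx hq; have := @s_pos (mshift (fun i => - x ord0 i) q) _ x Kx.
rewrite peval_Dop mshiftK; apply => y Ky.
by rewrite /peval meval_mshift; exact: hq.
Qed.

Let Ls_sqr p : 0 <= Ls (p ^+ 2).
Proof.
have [c Cc] := C_neq0.
apply: (riesz_functional_ge0_shift (cylinder_lift Cc (lexx 0))) => y _.
by rewrite rmorphXn/= sqr_ge0.
Qed.

Let Ls_base i : Ls 'X_(base i) = 0 /\ Ls ('X_(base i) ^+ 2) = 0.
Proof.
have cont : {within C, continuous (fun v : 'rV[R^o]_n => v ord0 i : R)}.
  by apply: continuous_subspaceT; exact: coord_continuous.
have [a /set_mem Ca amin] := compact_EVT_min C_neq0 C_compact cont.
have [b /set_mem Cb bmax] := compact_EVT_max C_neq0 C_compact cont.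
have bnd y : cylinder C y -> a ord0 i <= y ord0 (base i) <= b ord0 i.
  move=> [/mem_set Cy _]; have := amin _ Cy; have := bmax _ Cy.
  by rewrite !mxE => -> ->.
have Ka := cylinder_lift Ca (lexx 0); have Kb := cylinder_lift Cb (lexx 0).
have L1 : 0 <= Ls 'X_(base i).
  apply: (riesz_functional_ge0_shift Ka) => y /bnd /andP[ay yb].
  by rewrite mevalXU lift_row_base subr_ge0.
have L2 : Ls 'X_(base i) <= 0.
  (* The leading [0 +] gives the shape required by [riesz_functionalD]. *)
  have : 0 <= Ls (0 + (-1) *: 'X_(base i)).
    apply: (riesz_functional_ge0_shift Kb) => y /bnd /andP[ay yb].
    by rewrite add0r mevalZ mevalXU lift_row_base mulN1r oppr_ge0 subr_le0.
  rewrite /Ls riesz_functionalD {1}/riesz_functional msupp0 big_nil.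
  by rewrite add0r mulN1r oppr_ge0.
have L0 : Ls 'X_(base i) = 0 by apply/eqP; rewrite eq_le L1 L2.
split=> //; apply/eqP; rewrite eq_le Ls_sqr andbT.
have L3 : 0 <= Ls ((b ord0 i - a ord0 i) *: 'X_(base i) + (-1) *: 'X_(base i) ^+ 2).
  apply: (riesz_functional_ge0_shift Ka) => y /bnd /andP[ay yb].
  rewrite mevalD !mevalZ rmorphXn/= mevalXU lift_row_base mulN1r expr2.
  rewrite -mulrBl mulr_ge0 ?subr_ge0//; lra.
move: L3; rewrite -[_ *: 'X_(base i)]add0r /Ls !riesz_functionalD.
rewrite -/Ls L0 mulr0 addr0 {1}/Ls {1}/riesz_functional msupp0 big_nil.
by rewrite add0r mulN1r oppr_ge0.
Qed.

Let Ls_base_mul i g : Ls ('X_(base i) * g) = 0.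
Proof.
(* Cauchy-Schwarz: L((g + l 'X_i)^2) is affine in l. *)
apply/eqP; apply: contraT => B0.
set B := Ls _ in B0; pose A := Ls (g ^+ 2).
have h (l : R) : 0 <= A + 2 * l * B.
  have := Ls_sqr (g + l *: 'X_(base i)).
  have -> : (g + l *: 'X_(base i)) ^+ 2 =
     g ^+ 2 + (2 * l) *: ('X_(base i) * g) + (l ^+ 2) *: 'X_(base i) ^+ 2.
    rewrite sqrrD exprZn; congr (_ + _ + _).
    by rewrite -scalerAr mulrC scalerMnl mulr_natl.
  by rewrite /Ls !riesz_functionalD -/Ls (Ls_base i).2 mulr0 addr0.
(* At this [l] the affine function takes the value -1. *)
have := h (- (A + 1) / (2 * B)).
have -> : 2 * (- (A + 1) / (2 * B)) * B = - (A + 1) by field.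
by rewrite opprD addrA subrr add0r lerNr oppr0 ler10.
Qed.

Lemma moments_off_axis (a : 'X_{1..n.+1}) i : a (base i) != 0%N -> s a = 0.
Proof.
move=> ai; rewrite -(riesz_functionalX s a) (_ : a = U_(base i) + (a - U_(base i)))%MM.
  by rewrite mpolyXD; exact: Ls_base_mul.
by rewrite addmC submK// lep1mP.
Qed.

Let axis k : 'X_{1..n.+1} := (U_(ord_max) *+ k)%MM.

(** The base point is taken at height 0, so translating by it leaves the last coordinate, the only
    one occurring in [q], unchanged and non-negative. *)
Let axis_pos (p : {poly R}) : (forall t, 0 <= t -> 0 <= p.[t]) ->
  0 <= \sum_(i < size p) p`_i * s (axis i).
Proof.
move=> p0; have [c Cc] := C_neq0.
pose q : {mpoly R[n.+1]} := \sum_(i < size p) p`_i *: 'X_[axis i].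
have -> : \sum_(i < size p) p`_i * s (axis i) = Ls q.
  rewrite /q; elim/big_rec2: _ => [|i y x _ ->].
    by rewrite /Ls /riesz_functional msupp0 big_nil.
  by rewrite /Ls [in RHS]addrC riesz_functionalD riesz_functionalX addrC.
apply: (riesz_functional_ge0_shift (cylinder_lift Cc (lexx 0))) => y [_ y0].
have := p0 _ y0; rewrite horner_coef /q raddf_sum/=; congr (0 <= _).
apply: eq_bigr => i _; rewrite mevalZ mevalX; congr (_ * _).
rewrite (bigD1 ord_max)//= big1 ?mulr1.
  by rewrite lift_row_max subr0 mulmnE mnm1E eqxx mul1n.
by move=> j jm; rewrite mulmnE mnm1E eq_sym (negbTE jm) mul0n.
Qed.

Let axis_tuple (t : measurableTypeR R) : n.+1.-tuple R :=
  [tuple if j == ord_max then Num.max t 0 else 0 | j < n.+1].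

Let measurable_axis_tuple : measurable_fun setT axis_tuple.
Proof.
apply/measurable_fun_tnthP => i; case: (eqVneq i ord_max) => [im|im].
  rewrite (_ : _ \o _ = fun t => Num.max t 0); first exact: measurable_maxr.
  by apply/funext => t; rewrite /= tnth_mktuple im eqxx.
rewrite (_ : _ \o _ = cst 0); first exact: measurable_cst.
by apply/funext => t; rewrite /= tnth_mktuple (negbTE im).
Qed.

Let monom_axis_tuple (a : 'X_{1..n.+1}) t : monom_fun a (axis_tuple t) =
  (\prod_(i < n) 0 ^+ a (base i)) * Num.max t 0 ^+ a ord_max.
Proof.
rewrite /monom_fun big_ord_recr/= tnth_mktuple eqxx; congr (_ * _).
by apply: eq_bigr => i _; rewrite tnth_mktuple -/(base i) base_max.
Qed.

Let measurable_monom (a : 'X_{1..n.+1}) : measurable_fun setT (@monom_fun R n.+1 a).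
Proof.
apply: measurable_prod => i _; apply: measurable_funX; exact: measurable_tnth.
Qed.

(** The measure is the push-forward of [mu] along [axis_tuple]. It lives on the upper half of the
    last axis, whose translations map the cylinder into itself. *)
Lemma moment_seq_of_pos_preserver : moment_seq (Ksharp (cylinder C)) s.
Proof.
have [mu hmu] := stieltjes_moments (m := s \o axis) axis_pos.
pose nu : {measure set (n.+1.-tuple R) -> \bar R} :=
  @measure_function_pushforward__canonical__measure_function_Measure
    _ _ _ _ _ mu axis_tuple measurable_axis_tuple.
exists nu; split.
- move=> x suppx.
  (* A box around a support point has positive mass, so its preimage under [axis_tuple] is not
     empty. *)
  have near_x (e : R) : 0 < e ->
      exists t, forall i, `|tnth (axis_tuple t) i - x ord0 i| < e.
    move=> /suppx; apply: contraPP => /forallNP h.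
    rewrite /= /pushforward [X in mu X](_ : _ = set0) ?measure0 ?ltxx//.
    by apply/seteqP; split => // t /= /h.
  have x_max : 0 <= x ord0 ord_max.
    rewrite leNgt; apply/negP => x0.
    have [|t /(_ ord_max)] := near_x (- x ord0 ord_max); first by rewrite oppr_gt0.
    rewrite tnth_mktuple eqxx; apply/negP; rewrite -leNgt.
    rewrite (le_trans _ (ler_norm _))// lerDr le_max lexx orbT//.
  have x_base i : x ord0 (base i) = 0.
    apply/eqP; apply: contraT => x0.
    have [|t /(_ (base i))] := near_x `|x ord0 (base i)|; first by rewrite normr_gt0.
    by rewrite tnth_mktuple base_max sub0r normrN ltxx.
  move=> y [Cy y0]; split; last by rewrite mxE addr_ge0.
  rewrite (_ : \row_i _ = \row_i y ord0 (base i))//; apply/rowP => i.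
  by rewrite !mxE x_base add0r.
- move=> a; have mfa : measurable_fun setT (fun u => (@monom_fun R n.+1 a u)%:E).
    by apply/measurable_EFinP; exact: measurable_monom.
  have [ifa int_fa] : mu.-integrable setT (fun t => (monom_fun a (axis_tuple t))%:E) /\
      (\int[mu]_t (monom_fun a (axis_tuple t))%:E = (s a)%:E)%E.
    (* If [a] involves a base variable, the monomial vanishes on the axis and so does [s a].
       Otherwise the base factors are [0 ^+ 0 = 1], and a pure power of the last coordinate
       remains. *)
    have [/existsP[i ai]|/existsPn a0] := boolP [exists i, a (base i) != 0%N].
      rewrite (moments_off_axis ai).
      rewrite (_ : (fun t => _) = cst 0%E); last first.
        apply/funext => t; rewrite monom_axis_tuple (bigD1 i)//=.
        by rewrite expr0n (negbTE ai) !mul0r.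
      by split; [exact: integrable0|rewrite integral0].
    have aE : a = axis (a ord_max).
      apply/mnmP => j; rewrite mulmnE mnm1E; case: eqVneq => [<-|jm].
        by rewrite mul1n.
      have [i ji _] := unlift_some jm.
      by have := a0 i; rewrite negbK ji base_lift => /eqP.
    have e t : monom_fun a (axis_tuple t) = Num.max t 0 ^+ a ord_max.
      rewrite monom_axis_tuple big1 ?mul1r// => i _.
      by have := a0 i; rewrite negbK => /eqP ->; rewrite expr0.
    rewrite (_ : (fun t => _) = (fun t => (Num.max t 0 ^+ a ord_max)%:E)).
      by rewrite [in s a]aE; exact: hmu.
    by apply/funext => t; rewrite e.
  split.
    by apply: integrable_pushforward => //; exact: measurable_axis_tuple.
  by rewrite integral_pushforward.
Qed.

End Cylinder.

Theorem theorem4p17 (R : realType) (n : nat) (C : set 'rV[R^o]_n)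
    (C_neq0 : C !=set0) (C_compact : compact C) (s : 'X_{1..n.+1} -> R) :
  pos_preserver (cylinder C) (Dop s) <-> moment_seq (Ksharp (cylinder C)) s.
Proof.
split; first exact: moment_seq_of_pos_preserver.
move=> [mu [supp_mu mus]] p Kp x Kx; rewrite peval_Dop.
apply: (riesz_functional_ge0 mus supp_mu) => y Ky.
rewrite /peval meval_mshift; have := Kp _ (Ky _ Kx); rewrite /peval.
by congr (0 <= _); apply: meval_eq => i; rewrite mxE.
Qed.
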